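(* Let $0<s<1$, $0<p<\infty$ and $0<q\leq\infty$. Let $(X,d,\mu)$ be a metric measure space with $\mu$ doubling. Let $p^*>p$ and suppose $$M^s_{p,q}(X)\hookrightarrow L^{p^*}(X),$$ i.e. there is a constant $C_e>0$ such that $\|u\|_{L^{p^*}(X)}\le C_e\|u\|_{M^s_{p,q}(X)}$ for all $u\in M^s_{p,q}(X)$. Define $Q$ by $\frac1p-\frac1{p^*}=\frac sQ$. Then there exists a constant $C=C(s,p,q,p^*,C_e)>0$ such that $$\mu(B(x,r))\geq Cr^Q\qquad\text{for all }x\in X\text{ and } r\in(0,1].$$ The claim also holds with $M^s_{p,q}(X)$ replaced by $N^s_{p,q}(X)$ (with $C_e$ then the constant of the embedding $N^s_{p,q}(X)\hookrightarrow L^{p^*}(X)$).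
   Context: A metric measure space $(X,d,\mu)$ is a metric space $(X,d)$ with a Borel regular measure $\mu$ such that every nonempty open set has positive measure and every bounded set has finite measure. The measure $\mu$ is doubling if there is a constant $C_d\ge1$ with $\mu(B(x,2r))\le C_d\,\mu(B(x,r))$ for all $x\in X$, $r>0$. Let $S\subset X$ be measurable and $0<s<\infty$. A sequence $(g_k)_{k\in\mathbb Z}$ of nonnegative measurable functions is a fractional $s$-gradient of a measurable function $u:S\to[-\infty,\infty]$ in $S$ if there is a set $E\subset S$ with $\mu(E)=0$ such that $|u(x)-u(y)|\le d(x,y)^s(g_k(x)+g_k(y))$ for all $k\in\mathbb Z$ and all $x,y\in S\setminus E$ with $2^{k-1}\le d(x,y)<2^k$. Let $\mathbb D^s(u)$ be the collection of all fractional $s$-gradients of $u$. For $0<p,q\le\infty$ and a sequence $\vec f=(f_k)_{k\in\mathbb Z}$ of measurable functions put $\|\vec f\|_{L^p(S,l^q)}=\big\|\,\|(f_k)_k\|_{l^q}\big\|_{L^p(S)}$ and $\|\vec f\|_{l^q(L^p(S))}=\big\|(\|f_k\|_{L^p(S)})_{k}\big\|_{l^q}$, where $\|(f_k)_k\|_{l^q}=(\sum_{k\in\mathbb Z}|f_k|^q)^{1/q}$ for $q<\infty$ and $\sup_{k\in\mathbb Z}|f_k|$ for $q=\infty$. The homogeneous Hajłasz–Triebel–Lizorkin space $\dot M^s_{p,q}(S)$ consists of measurable $u:S\to[-\infty,\infty]$ with $\|u\|_{\dot M^s_{p,q}(S)}=\inf_{\vec g\in\mathbb D^s(u)}\|\vec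 g\|_{L^p(S,l^q)}<\infty$, and $M^s_{p,q}(S)=\dot M^s_{p,q}(S)\cap L^p(S)$ with norm $\|u\|_{M^s_{p,q}(S)}=\|u\|_{L^p(S)}+\|u\|_{\dot M^s_{p,q}(S)}$. The homogeneous Hajłasz–Besov space $\dot N^s_{p,q}(S)$ consists of measurable $u:S\to[-\infty,\infty]$ with $\|u\|_{\dot N^s_{p,q}(S)}=\inf_{\vec g\in\mathbb D^s(u)}\|\vec g\|_{l^q(L^p(S))}<\infty$, and $N^s_{p,q}(S)=\dot N^s_{p,q}(S)\cap L^p(S)$ with norm $\|u\|_{N^s_{p,q}(S)}=\|u\|_{L^p(S)}+\|u\|_{\dot N^s_{p,q}(S)}$. *)

(* Defs.v *)
From HB Require Import structures.
From mathcomp Require Import all_boot all_order all_algebra.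
From mathcomp Require Import all_classical all_reals all_analysis.
From mathcomp Require Import measurable_realfun.
Set Implicit Arguments.
Unset Strict Implicit.
Unset Printing Implicit Defensive.
Import Order.TTheory GRing.Theory Num.Theory.
Local Open Scope classical_set_scope.
Local Open Scope ring_scope.
Local Open Scope ereal_scope.

(* Measurable types are pointed in MathComp-Analysis, so the metric spaces
   below are nonempty. *)
#[short(type="pmetricType")]
HB.structure Definition PointedMetric (K : numDomainType) :=
  {T of Metric K T & Pointed T}.

(* As usual in analysis on metric spaces, a Borel regular measure is an outer
   measure on all subsets of X; measurability of sets and functions is meant
   in the sense of Caratheodory, i.e. with respect to [caratheodory_type mu]. *)
Section MetricMeasureSpace.
Context {R : realType} {X : pmetricType R}.
Variable mu : {outer_measure set X -> \bar R}.

Definition borel_regular : Prop :=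
  (forall A : set X, <<s @open X >> A -> mu.-caratheodory A) /\
  (forall A : set X, exists B : set X, [/\ <<s @open X >> B, A `<=` B & mu A = mu B]).

Definition metric_measure_space : Prop :=
  [/\ borel_regular,
      forall U : set X, open U -> U !=set0 -> 0 < mu U
    & forall (A : set X) (x : X) (r : R), A `<=` ball x r -> mu A < +oo].

Definition doubling : Prop :=
  exists2 Cd : R, (1 <= Cd)%R &
    forall (x : X) (r : R), (0 < r)%R ->
      mu (ball x (2 * r)%R) <= Cd%:E * mu (ball x r).

Definition cara_measure : {measure set (caratheodory_type mu) -> \bar R} :=
  (mu : set (caratheodory_type mu) -> \bar R).

End MetricMeasureSpace.

(* The value at q = -oo is irrelevant: only q > 0 is used. *)
Definition lqnorm {R : realType} (q : \bar R) (a : int -> \bar R) : \bar R :=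
  match q with
  | q%:E => (\esum_(k in [set: int]) `|a k| `^ q) `^ q^-1
  | _ => ereal_sup [set `|a k| | k in [set: int]]
  end.

Section HajlaszSpaces.
Context {R : realType} {X : pmetricType R}.
Variable mu : {outer_measure set X -> \bar R}.
Implicit Types (s : R) (p q : \bar R) (u : X -> \bar R) (g : int -> X -> \bar R).

Definition mu_measurable u : Prop := 
  measurable_fun setT (u : caratheodory_type mu -> \bar R).

Definition lpnorm p u : \bar R := 'N[cara_measure mu]_p [u].

(* In \bar R, `|u x - u y| = +oo as soon as u x or u y is infinite, even when
   u x = u y. *)
Definition fractional_gradient s u g : Prop :=
  [/\ forall k, mu_measurable (g k),
      forall k x, 0 <= g k x
    & exists2 E : set X, mu E = 0 &
        forall (k : int) (x y : X), ~ E x -> ~ E y ->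
          (2 ^ (k - 1) <= mdist x y < 2 ^ k)%R ->
          `|u x - u y| <= ((mdist x y) `^ s)%:E * (g k x + g k y)].

Definition LplqNorm p q g : \bar R := lpnorm p (fun x => lqnorm q (g ^~ x)).

Definition lqLpNorm p q g : \bar R := lqnorm q (fun k => lpnorm p (g k)).

Definition dotMnorm s p q u : \bar R :=
  ereal_inf [set LplqNorm p q g | g in fractional_gradient s u].

Definition dotNnorm s p q u : \bar R :=
  ereal_inf [set lqLpNorm p q g | g in fractional_gradient s u].

Definition Mnorm s p q u : \bar R := lpnorm p u + dotMnorm s p q u.

Definition Nnorm s p q u : \bar R := lpnorm p u + dotNnorm s p q u.

Definition Mspace s p q : set (X -> \bar R) :=
  [set u | [/\ mu_measurable u, lpnorm p u < +oo & dotMnorm s p q u < +oo]].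

Definition Nspace s p q : set (X -> \bar R) :=
  [set u | [/\ mu_measurable u, lpnorm p u < +oo & dotNnorm s p q u < +oo]].

Definition M_embedding s p q (ps : \bar R) (Ce : R) : Prop :=
  forall u, Mspace s p q u -> lpnorm ps u <= Ce%:E * Mnorm s p q u.

Definition N_embedding s p q (ps : \bar R) (Ce : R) : Prop :=
  forall u, Nspace s p q u -> lpnorm ps u <= Ce%:E * Nnorm s p q u.

End HajlaszSpaces.

(* Main.v *)
Require Import Defs.
From mathcomp Require Import all_boot all_order all_algebra.
From mathcomp Require Import all_classical all_reals all_analysis.
From mathcomp Require Import measurable_realfun ess_sup_inf lra ring.
Import Order.TTheory GRing.Theory Num.Theory.
Import numFieldNormedType.Exports.
Local Open Scope classical_set_scope.
Local Open Scope ring_scope.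
Local Open Scope ereal_scope.

(** The embedding is tested on the cut-offs u that equal 1 on a ball B(x, r/2),
    vanish outside B(x, r) and are 2/r-Lipschitz.  Since u oscillates at most by
    min(1, 2d/r) over the distance d, the functions h_k 1_{B(x, r)} form a
    fractional s-gradient of u as soon as h_k >= min(1, 2d/r) / d^s for d ~ 2^k;
    because 0 < s < 1, the h_k may be taken to be r^{-s} times a sequence that
    decays geometrically away from k ~ log_2 r, so that its l^q norm is
    A r^{-s} with A = A(s, q) ([cutoff_gradientP], [lqnorm_cutoff_weight]).
    As each h_k multiplies the same indicator, both orders of taking the l^q and
    L^p norms give the value A r^{-s} mu(B(x, r))^{1/p}, which is why the
    Triebel-Lizorkin and the Besov cases are the same.  With r <= 1 the embedding
    then reads
      mu(B(x, r/2))^{1/ps} <= Ce (1 + A) r^{-s} mu(B(x, r))^{1/p},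
    also for ps = oo, where the left-hand side is 1 ([cutoff_estimate]).

    Replacing mu(B(x, r/2)) by mu(B(x, r)) through the doubling condition would
    finish the proof at once, but with a constant depending on the doubling
    constant.  Instead the inequality is iterated over the radii r = 2^{-n}
    ([dyadic_growth_lower_bound]).  Set
      L_n = ln (mu(B(x, 2^{-n})) / (2^{-n})^Q) + E.
    As s = (1/p - 1/ps) Q, the powers of r cancel, and for a suitable E
    the inequality says theta L_{n+1} <= L_n with theta = p/ps < 1.
    Doubling serves only to show that L_n is bounded below; theta^k L_{n+k} then
    has a nonnegative lower limit, hence L_n >= 0, whatever that
    bound was ([ge0_of_contracting_lower_bound]).  This is the claim at dyadic
    radii, and every r in (0, 1] lies within a factor 2 above a dyadic radius. *)

(** * Iteration over dyadic scales *)

Section RealIteration.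
Context {R : realType}.
Local Open Scope ring_scope.

(** The two hypotheses together bound L below by -M: L n >= theta L (n+1)
    >= theta (L n - D).  Feeding the bound back into the first one k times
    improves it to -theta^k M, which tends to 0. *)
Lemma ge0_of_contracting_lower_bound (L : nat -> R) (theta D : R) :
  0 <= theta < 1 ->
  (forall n, theta * L n.+1 <= L n) ->
  (forall n, L n <= L n.+1 + D) ->
  forall n, 0 <= L n.
Proof.
move=> /andP[th0 th1] Lcontr Llip.
pose M := theta * D / (1 - theta).
have ge_M n : - M <= L n.
  have : theta * (L n - D) <= L n.
    by apply: le_trans (Lcontr n); rewrite ler_wpM2l// lerBlDr.
  rewrite /M -mulNr ler_pdivrMr ?subr_gt0//; nra.
have ge_pow k n : - (theta ^+ k * M) <= L n.
  elim: k n => [|k IHk] n; first by rewrite expr0 mul1r.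
  apply: le_trans (Lcontr n).
  by rewrite exprS -mulrA -mulrN ler_wpM2l.
move=> n; rewrite -oppr_le0.
have cvg0 : (theta ^+ k * M) @[k --> \oo] --> 0.
  rewrite -(mul0r M); apply: cvgMl; apply: cvg_expr.
  by rewrite ger0_norm.
rewrite -(cvg_lim _ cvg0)//.
apply: limr_ge; first by apply/cvg_ex; exists 0.
by apply: nearW => k; rewrite lerNl.
Qed.

(** D enters only the a priori bound that starts the iteration, so that the
    constant is uniform in it.  The additive constant E below is the fixed
    point of the affine recursion that ln (m n) + n Q ln 2 satisfies. *)
Lemma dyadic_growth_lower_bound (m : nat -> R) (a b s Q K D : R) :
  0 <= a -> a < b -> b - a = s / Q -> 0 < Q -> 0 < K -> 0 < D ->
  (forall n, 0 < m n) ->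
  (forall n, m n <= D * m n.+1) ->
  (forall n, m n.+1 `^ a <= K * 2 `^ (n%:R * s) * m n `^ b) ->
  forall n, expR (- ((ln K + a * Q * ln 2) / (b - a))) * 2 `^ (- n%:R * Q) <= m n.
Proof.
move=> a0 ab abQ Q0 K0 D0 m0 mD mrec.
have b0 : 0 < b by apply: le_lt_trans ab.
set E := (_ / _).
pose L n := ln (m n) + n%:R * Q * ln 2 + E.
have ab0 : b - a != 0 by rewrite subr_eq0 gt_eqF.
have sE : s = (b - a) * Q by rewrite abQ divfK// gt_eqF.
have EE : (b - a) * E = ln K + a * Q * ln 2 by rewrite /E mulrC divfK.
have L0 n : 0 <= L n.
  apply: (@ge0_of_contracting_lower_bound L (a / b) (ln D)).
  - by rewrite divr_ge0 ?(ltW b0)//= ltr_pdivrMr// mul1r.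
  - move=> {}n; rewrite mulrAC ler_pdivrMr//.
    have := mrec n; rewrite -ler_ln ?posrE ?mulr_gt0 ?powR_gt0//.
    rewrite !lnM ?posrE ?mulr_gt0 ?powR_gt0// !ln_powR => H.
    rewrite /L -natr1.
    have -> : a * (ln (m n.+1) + (n%:R + 1) * Q * ln 2 + E) =
      a * ln (m n.+1) + a * n%:R * Q * ln 2 + (a * Q * ln 2 + a * E) by ring.
    have -> : (ln (m n) + n%:R * Q * ln 2 + E) * b =
      ln K + n%:R * s * ln 2 + b * ln (m n) + a * n%:R * Q * ln 2
      + (a * Q * ln 2 + a * E).
      have -> : b * ln (m n) = ln (m n) * b by rewrite mulrC.
      have -> : ln K = (b - a) * E - a * Q * ln 2 by rewrite EE; ring.
      by rewrite sE; ring.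
    by rewrite !lerD2r.
  - move=> {}n; have := mD n; rewrite -ler_ln ?posrE ?mulr_gt0//.
    rewrite lnM ?posrE// => H.
    have : 0 <= Q * ln 2.
      by rewrite mulr_ge0 ?(ltW Q0)// ln_ge0// ler1n.
    rewrite /L -natr1; lra.
move=> n; rewrite -ler_ln ?posrE ?mulr_gt0 ?expR_gt0 ?powR_gt0//.
rewrite lnM ?posrE ?expR_gt0 ?powR_gt0// expRK ln_powR.
by have := L0 n; rewrite /L; lra.
Qed.

Lemma dyadic_bracket (r : R) : 0 < r <= 1 ->
  exists n, 2 `^ (- n%:R) <= r <= 2 * 2 `^ (- n%:R).
Proof.
move=> /andP[r0 r1].
have exn : exists n, (2 : R) `^ (- n%:R) <= r.
  exists (Num.truncn r^-1).+1; rewrite powRN powR_mulrn//.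
  rewrite invf_ple ?posrE ?exprn_gt0//.
  rewrite (le_trans (ltW (truncnS_gt _)))//.
  by rewrite -natrX ler_nat ltnW// ltn_expl.
case: (ex_minnP exn) => n nr nmin; exists n; rewrite nr/=.
case: n nr nmin => [|n] nr nmin.
  by rewrite oppr0 powRr0 mulr1 (le_trans r1)// ler1n.
have -> : 2 * 2 `^ (- n.+1%:R) = 2 `^ (- n%:R) :> R.
  rewrite -{1}(@powRr1 _ 2)// -powRD ?pnatr_eq0 ?implybT//.
  by congr powR; rewrite -natr1; ring.
by rewrite leNgt; apply/negP => /ltW/nmin; rewrite ltnn.
Qed.

End RealIteration.

(** * The l^q quasi-norm of sequences indexed by the integers *)

Section LqNorm.
Context {R : realType}.
Implicit Types (q : \bar R) (a : int -> \bar R).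

Lemma ge0_esumZl {T : choiceType} (I : set T) (a : T -> \bar R) (c : R) :
  (forall i, 0 <= a i) -> (0 <= c)%R ->
  \esum_(i in I) (c%:E * a i) = c%:E * \esum_(i in I) a i.
Proof.
move=> a0 c0; rewrite /esum -ereal_supZl//.
  congr ereal_sup; rewrite image_comp; apply: eq_imagel => A _ /=.
  by rewrite ge0_mule_fsumr.
by apply/set0P; exists 0, set0; [exact: fsets_set0|exact: fsbig_set0].
Qed.

Lemma lqnormZ q (c : R) a : 0 < q -> (0 <= c)%R ->
  lqnorm q (fun k => c%:E * a k) = c%:E * lqnorm q a.
Proof.
case: q => [q| |]//= q0 c0.
- under eq_esum => k _ do rewrite abseM poweRM// gee0_abs ?lee_fin// poweR_EFin.
  rewrite ge0_esumZl ?powR_ge0//; last by move=> k; exact: poweR_ge0.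
  rewrite poweRM ?lee_fin ?powR_ge0//; last first.
    by apply: esum_ge0 => k _; exact: poweR_ge0.
  by rewrite poweR_EFin -powRrM mulfV ?powRr1// gt_eqF.
- rewrite -ereal_supZl//; last by apply/set0P; exists `|a 0%R|, 0%R.
  congr ereal_sup; rewrite image_comp; apply: eq_imagel => k _ /=.
  by rewrite abseM gee0_abs// lee_fin.
Qed.

Lemma lqnorm_shift q a (n : int) : 0 < q ->
  lqnorm q (fun k => a (k + n)%R) = lqnorm q a.
Proof.
have addn_bij : set_bij [set: int] [set: int] (fun k => k + n)%R.
  split => //; first by move=> i j _ _; apply: addIr.
  by move=> i _; exists (i - n)%R => //; rewrite subrK.
case: q => [q| |]//= q0.
  by rewrite [in RHS](reindex_esum _ _ _ _ addn_bij).
congr ereal_sup; apply/seteqP; split => _ [k _ <-].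
  by exists (k + n)%R.
by exists (k - n)%R => //; rewrite subrK.
Qed.

Lemma lqnorm_ge0 q a : 0 < q -> 0 <= lqnorm q a.
Proof.
case: q => [q| |]//= q0; first exact: poweR_ge0.
by apply: (le_trans (abse_ge0 (a 0%R))); apply: ereal_sup_ubound; exists 0%R.
Qed.

(** The integers split into two copies of the naturals, along each of which
    the absolute value dominates the index. *)
Lemma geometric_esum_lty (A z : R) : (0 <= A)%R -> (0 <= z < 1)%R ->
  \esum_(k in [set: int]) (A * z ^+ `|k|%N)%:E < +oo.
Proof.
move=> A0 /andP[z0 z1].
have term0 (k : nat) : (0 <= A * z ^+ k)%R by rewrite mulr_ge0// exprn_ge0.
have geo_lty (e : nat -> int) : injective e ->
    (forall n, n <= `|e n|)%N ->
    \esum_(k in range e) (A * z ^+ `|k|%N)%:E < +oo.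
  move=> einj ege.
  rewrite esum_image; last by move=> ? ? _ _; exact: einj.
  apply: (@le_lt_trans _ _ (\esum_(n in [set: nat]) (A * z ^+ n)%:E)).
    apply: le_esum => n _; rewrite lee_fin ler_wpM2l//.
    by rewrite ler_wiXn2l// ltW.
  rewrite -nneseries_esumT; last by move=> n; rewrite lee_fin.
  have zn1 : (`|z| < 1)%R by rewrite ger0_norm.
  rewrite (_ : (fun _ => _) = EFin \o series (geometric A z)); last first.
    by apply/funext => n /=; rewrite sumEFin.
  by rewrite EFin_lim ?ltry//; exact: is_cvg_geometric_series.
rewrite (esumID (range Posz)); last by move=> k _; rewrite lee_fin.
rewrite !setTI lte_add_pinfty//; first by apply: geo_lty => // i j [].
rewrite (_ : ~` range Posz = range Negz); last first.
  apply/seteqP; split => [[n nPosz|n _]|_ [n _ <-] []//].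
    by case: nPosz; exists n.
  by exists n.
apply: geo_lty => [i j []//|n]; exact: leqnSn.
Qed.

Lemma lqnorm_geometric_lty q (A z : R) : 0 < q -> (0 <= A)%R -> (0 < z < 1)%R ->
  lqnorm q (fun k => (A * z ^+ `|k|%N)%:E) < +oo.
Proof.
move=> q0 A0 /andP[z0 z1].
have term0 (k : int) : (0 <= A * z ^+ `|k|%N)%R.
  by rewrite mulr_ge0// exprn_ge0// ltW.
case: q q0 => [q| |]//= q0.
- apply: poweR_lty; rewrite (@eq_esum _ _ _ _
    (fun k : int => ((A `^ q) * (z `^ q) ^+ `|k|%N)%:E)).
    apply: geometric_esum_lty; first exact: powR_ge0.
    rewrite powR_ge0/= -[ltRHS](congr1 (@^~ q) (powR1 R)).
    by apply: gt0_ltr_powR => //; rewrite nnegrE ltW.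
  move=> k _; rewrite /= ger0_norm// powRM ?exprn_ge0 ?(ltW z0)//.
  rewrite -(powR_mulrn _ (ltW z0)) -(powR_mulrn _ (powR_ge0 z q)).
  by rewrite powRAC.
- apply: (@le_lt_trans _ _ A%:E); last exact: ltry.
  apply: ge_ereal_sup => _ [k _ <-]; rewrite /= ger0_norm// lee_fin.
  by rewrite ler_piMr// exprn_ile1// ltW.
Qed.

End LqNorm.

(** * Lipschitz cut-offs and their oscillation *)

Section Cutoff.
Context {R : realType}.
Local Open Scope ring_scope.

Definition cutoff {X : pmetricType R} (x : X) (r : R) (y : X) : R :=
  Num.min 1 (Num.max 0 (2 - 2 * mdist x y / r)).

Lemma cutoff_ge0 {X : pmetricType R} (x : X) r y : 0 <= cutoff x r y.
Proof. by rewrite /cutoff le_min ler01 le_max lexx. Qed.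

Lemma cutoff_le1 {X : pmetricType R} (x : X) r y : cutoff x r y <= 1.
Proof. by rewrite /cutoff ge_min lexx. Qed.

Lemma cutoff_out {X : pmetricType R} (x : X) r y : 0 < r ->
  ~ ball x r y -> cutoff x r y = 0.
Proof.
move=> r0; rewrite ballEmdist/= => /negP; rewrite -leNgt => rd.
rewrite /cutoff max_l ?min_r// subr_le0 -mulrA ler_pMr//.
by rewrite ler_pdivlMr// mul1r.
Qed.

Lemma cutoff_half_ball {X : pmetricType R} (x : X) r y : 0 < r ->
  ball x (r / 2) y -> cutoff x r y = 1.
Proof.
move=> r0; rewrite ballEmdist/= => dr.
rewrite /cutoff min_l// le_max; apply/orP; right.
rewrite lerBrDl -lerBrDr ler_pdivrMr//; lra.
Qed.

Lemma cutoff_lipschitz {X : pmetricType R} (x : X) r y z : 0 < r ->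
  `|cutoff x r y - cutoff x r z| <= 2 * mdist y z / r.
Proof.
move=> r0.
have clamp_lip (a b : R) :
    `|Num.min 1 (Num.max 0 a) - Num.min 1 (Num.max 0 b)| <= `|a - b|.
  rewrite ler_norml; have := ler_norm (a - b); have := ler_norm (b - a).
  rewrite -(distrC a b) => H1 H2.
  have [a0|a0] := leP 0 a; have [b0|b0] := leP 0 b;
  have [a1|a1] := leP 1 a; have [b1|b1] := leP 1 b;
  rewrite ?(min_r ler01); lra.
apply: le_trans (clamp_lip _ _) _.
have -> : 2 - 2 * mdist x y / r - (2 - 2 * mdist x z / r) =
  2 / r * (mdist x z - mdist x y) by ring.
rewrite normrM ger0_norm ?divr_ge0 ?(ltW r0)// mulrAC ler_pM2r ?invr_gt0//.
rewrite ler_pM2l// ler_norml.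
have := metric_triangle x y z; have := metric_triangle x z y.
rewrite (metric_sym z y); lra.
Qed.

Lemma cutoff_osc_le1 {X : pmetricType R} (x : X) r y z :
  `|cutoff x r y - cutoff x r z| <= 1.
Proof.
have := cutoff_ge0 x r y; have := cutoff_le1 x r y.
have := cutoff_ge0 x r z; have := cutoff_le1 x r z.
by rewrite ler_norml; lra.
Qed.

(** The exponent s (1 - s) is below both s and 1 - s, the rates at which
    min(1, 2e) / e^s decays at infinity and at 0. *)
Definition decay (s : R) : R := 2 `^ (- (s * (1 - s))).

(** Comparison of exponents of 2 after writing e = 2^t with j - 1 <= t < j:
    for j > 0 the bound 1 is used, for j <= 0 the bound 2e. *)
Lemma min1_le_powR_decay (s e : R) (j : int) : 0 < s < 1 ->
  2 ^ (j - 1) <= e < 2 ^ j ->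
  Num.min 1 (2 * e) <= e `^ s * (2 * decay s ^+ `|j|%N).
Proof.
move=> /andP[s0 s1]; rewrite -!powR_intmul//.
have two0 : (2 : R) != 0 by rewrite pnatr_eq0.
have ln20 : 0 < ln 2 :> R by rewrite ln_gt0// ltr1n.
move=> /andP[je ej]; have e0 : 0 < e by apply: lt_le_trans je; rewrite powR_gt0.
pose t := ln e / ln 2.
have eE : e = 2 `^ t.
  by apply: ln_inj; rewrite ?posrE ?powR_gt0// ln_powR divfK// gt_eqF.
have jt : (j - 1)%:~R <= t.
  by rewrite ler_pdivlMr// -ln_powR ler_ln ?posrE ?powR_gt0.
have tj : t < j%:~R.
  by rewrite ltr_pdivrMr// -ln_powR ltr_ln ?posrE ?powR_gt0.
have pow_mul2 u : 2 * 2 `^ u = 2 `^ (1 + u) :> R.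
  by rewrite powRD ?two0 ?implybT// powRr1.
have powD u v : 2 `^ u * 2 `^ v = 2 `^ (u + v) :> R.
  by rewrite powRD// two0 implybT.
rewrite /decay -powR_mulrn ?powR_ge0// -powRrM {2}eE -powRrM mulrCA powD.
rewrite pow_mul2 ge_min; move: jt; rewrite rmorphB/= => jt.
case: j je ej jt tj => j je ej jt tj.
- apply/orP; left; rewrite -{1}(powRr0 2); apply: ler_powR; first by rewrite ler1n.
  rewrite absz_nat; move: jt; rewrite -pmulrn => jt.
  have := ler0n R j; nra.
- apply/orP; right; rewrite eE pow_mul2; apply: ler_powR; first by rewrite ler1n.
  move: tj jt; rewrite NegzE abszN absz_nat mulrNz -pmulrn => tj jt.
  set J := j.+1%:R in tj jt *; have J0 : 0 <= J by exact: ler0n.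
  have : 0 <= (- J - t) * (1 - s).
    by rewrite mulr_ge0 ?subr_ge0// ltW.
  have : 0 <= J * ((1 - s) * (1 - s)).
    by rewrite !mulr_ge0// subr_ge0 ltW.
  lra.
Qed.

(** Scaling by r = 2^{-n} turns distances d ~ 2^k into d / r ~ 2^{k+n}, whence
    the shift by n, and d^s into r^s (d / r)^s, whence the factor 2^{ns}. *)
Definition cutoff_weight (s : R) (n : nat) (k : int) : R :=
  2 `^ (n%:R * s) * (2 * decay s ^+ `|(k + n%:Z)%R|%N).

Lemma cutoff_weight_ge0 s n k : 0 <= cutoff_weight s n k.
Proof. by rewrite !mulr_ge0 ?powR_ge0// exprn_ge0// powR_ge0. Qed.

Lemma cutoff_osc_le_weight {X : pmetricType R} (x y z : X) (s : R) n k :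
  0 < s < 1 -> 2 ^ (k - 1) <= mdist y z < 2 ^ k ->
  `|cutoff x (2 `^ (- n%:R)) y - cutoff x (2 `^ (- n%:R)) z| <=
    mdist y z `^ s * cutoff_weight s n k.
Proof.
move=> s01 /andP[dlo dhi].
set r := 2 `^ _; have r0 : 0 < r by rewrite powR_gt0.
have rVE : r^-1 = 2 ^ n%:Z by rewrite /r powRN invrK powR_mulrn.
pose e := mdist y z / r.
apply: (@le_trans _ _ (Num.min 1 (2 * e))).
  by rewrite le_min cutoff_osc_le1 mulrA cutoff_lipschitz.
have -> : mdist y z `^ s * cutoff_weight s n k =
    e `^ s * (2 * decay s ^+ `|(k + n%:Z)%R|%N).
  rewrite /e powRM ?mdist_ge0 ?invr_ge0 ?(ltW r0)// rVE.
  rewrite /cutoff_weight -powR_intmul// -powRrM.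
  by rewrite !mulrA.
apply: min1_le_powR_decay => //.
have two0 : (2 : R) != 0 by rewrite pnatr_eq0.
rewrite addrAC !expfzDr// -rVE /e ler_pM2r ?invr_gt0// ltr_pM2r ?invr_gt0//.
by rewrite -expfzDr// dlo.
Qed.

End Cutoff.

(** * Measure of balls and L^p norms of cut-offs *)

Section BallMeasure.
Context {R : realType} {X : pmetricType R}.
Variable mu : {outer_measure set X -> \bar R}.
Hypothesis mms : metric_measure_space mu.
Implicit Types (x y : X) (r : R).

Lemma open_metric_ball x r : open (ball x r).
Proof.
rewrite openE => y; rewrite ballEmdist /= => xyr.
apply/nbhs_ballP; exists (r - mdist x y)%R => /=; first by rewrite subr_gt0.
move=> z; rewrite ballEmdist/= ltrBrDl => /(le_lt_trans _); apply.
exact: metric_triangle.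
Qed.

Lemma measurable_metric_ball x r :
  measurable (ball x r : set (caratheodory_type mu)).
Proof.
have [[borel _] _ _] := mms; apply: borel.
by apply: sub_sigma_algebra; exact: open_metric_ball.
Qed.

Lemma ball_measure_gt0 x r : (0 < r)%R -> 0 < mu (ball x r).
Proof.
move=> r0; have [_ + _] := mms; apply; first exact: open_metric_ball.
by exists x; rewrite ballEmdist/= mdistxx.
Qed.

Lemma ball_measure_fin_num x r : mu (ball x r) \is a fin_num.
Proof.
have [_ _ finmu] := mms; rewrite ge0_fin_numE; last exact: outer_measure_ge0.
exact: (finmu _ x r).
Qed.

Lemma measurable_mdist x :
  measurable_fun setT (mdist x : caratheodory_type mu -> R).
Proof.
apply: (measurability _ (RGenInftyO.measurableE R)) => _ [_ [r ->] <-].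
rewrite setTI (_ : _ @^-1` _ = ball x r); first exact: measurable_metric_ball.
by rewrite ballEmdist; apply/seteqP; split => y /=; rewrite in_itv.
Qed.

Lemma measurable_cutoff x r : mu_measurable mu (EFin \o cutoff x r).
Proof.
apply/measurable_EFinP; apply: measurable_minr; first exact: measurable_cst.
apply: measurable_maxr; first exact: measurable_cst.
apply: measurable_funB; first exact: measurable_cst.
apply: measurable_funM; last exact: measurable_cst.
by apply: measurable_funM; [exact: measurable_cst|exact: measurable_mdist].
Qed.

Lemma measurable_scaled_ball x r (c : R) :
  mu_measurable mu (fun y => (c * \1_(ball x r) y)%:E).
Proof.
apply/measurable_EFinP; apply: measurable_funM; first exact: measurable_cst.
exact/measurable_indic/measurable_metric_ball.
Qed.

Lemma lpnorm_scaled_ball x r (c p : R) : (0 <= c)%R -> (0 < p)%R ->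
  lpnorm mu p%:E (fun y => (c * \1_(ball x r) y)%:E) =
    c%:E * (mu (ball x r) `^ p^-1).
Proof.
move=> c0 p0; rewrite /lpnorm unlock.
under eq_integral => y _.
  rewrite /= ger0_norm ?mulr_ge0// powRM// EFinM.
  rewrite (_ : (\1_(ball x r) y `^ p)%R = \1_(ball x r) y); last first.
    by rewrite indicE; case: (_ \in _); rewrite ?powR1// powR0 ?gt_eqF.
  over.
rewrite ge0_integralZl_EFin ?powR_ge0//=; last first.
  exact/measurable_EFinP/measurable_indic/measurable_metric_ball.
rewrite integral_indic ?setIT//; last exact: measurable_metric_ball.
rewrite poweRM ?lee_fin ?powR_ge0//=.
by rewrite -powRrM mulfV ?powRr1// gt_eqF.
Qed.

Lemma le_lpnorm (p : R) (f g : X -> \bar R) : (0 < p)%R ->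
  mu_measurable mu f -> mu_measurable mu g ->
  (forall y, `|f y| <= `|g y|) -> lpnorm mu p%:E f <= lpnorm mu p%:E g.
Proof.
move=> p0 mf mg fg; rewrite /lpnorm unlock.
have pow_ge0 (h : X -> \bar R) (y : caratheodory_type mu) :
    [set: caratheodory_type mu] y -> 0 <= `|h y| `^ p.
  by move=> _; exact: poweR_ge0.
have pow_meas (h : X -> \bar R) : mu_measurable mu h ->
    measurable_fun setT (fun y : caratheodory_type mu => `|h y| `^ p).
  move=> mh; apply: (@measurableT_comp _ _ _ _ _ _ (fun a : \bar R => `|a| `^ p)) => //.
  exact: (measurableT_comp (measurable_poweR _)).
apply: gt0_ler_poweR; rewrite ?invr_ge0 ?(ltW p0)//.
- by rewrite in_itv/= leey andbT; apply: integral_ge0; exact: pow_ge0.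
- by rewrite in_itv/= leey andbT; apply: integral_ge0; exact: pow_ge0.
apply: ge0_le_integral => //;
  [exact: pow_ge0|exact: pow_meas|exact: pow_meas|].
move=> y _; apply: gt0_ler_poweR; rewrite ?(ltW p0)//.
- by rewrite in_itv/= leey andbT.
- by rewrite in_itv/= leey andbT.
Qed.

Lemma lpnorm_cutoff_le x r (p : R) : (0 < r)%R -> (0 < p)%R ->
  lpnorm mu p%:E (EFin \o cutoff x r) <= mu (ball x r) `^ p^-1.
Proof.
move=> r0 p0; rewrite -[leRHS]mul1e -lpnorm_scaled_ball//.
apply: le_lpnorm => // [||y];
  [exact: measurable_cutoff|exact: measurable_scaled_ball|].
rewrite /= lee_fin mul1r !ger0_norm ?cutoff_ge0// indicE.
have [yB|yB] := pselect (ball x r y); first by rewrite mem_set// cutoff_le1.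
by rewrite memNset// cutoff_out.
Qed.

(** For t = +oo the exponent is 0 and the left-hand side is 1: the essential
    supremum is at least 1 because the half ball has positive measure. *)
Lemma le_lpnorm_cutoff x r (t : \bar R) : (0 < r)%R -> 0 < t ->
  mu (ball x (r / 2)%R) `^ (fine t^-1) <= lpnorm mu t (EFin \o cutoff x r).
Proof.
move=> r0; have r20 : (0 < r / 2)%R by rewrite divr_gt0.
case: t => [t| |]// t0.
- rewrite inver gt_eqF//= -[leLHS]mul1e -lpnorm_scaled_ball//.
  apply: le_lpnorm => // [||y];
    [exact: measurable_scaled_ball|exact: measurable_cutoff|].
  rewrite /= lee_fin mul1r !ger0_norm ?cutoff_ge0// indicE.
  have [yB|yB] := pselect (ball x (r / 2) y).
    by rewrite mem_set// cutoff_half_ball.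
  by rewrite memNset// cutoff_ge0.
- rewrite poweRe0 /lpnorm unlock ifT; last first.
    have := lt_le_trans (ball_measure_gt0 x _ r20).
    by move=> /(_ (mu setT)); apply; exact: le_outer_measure.
  rewrite leNgt; apply/negP => sup_lt1.
  have [N [_ N0 cutN]] := ess_sup_ge (cara_measure mu)
    (abse \o (EFin \o cutoff x r)).
  have := ball_measure_gt0 x _ r20; apply/negP; rewrite -leNgt -N0.
  apply: le_outer_measure => y /cutoff_half_ball cut1.
  apply: cutN => /= /le_lt_trans.
  by move=> /(_ _ sup_lt1); rewrite cut1// normr1 ltxx.
Qed.

End BallMeasure.

(** * The cut-offs in the Hajlasz spaces *)

Section CutoffGradient.
Context {R : realType} {X : pmetricType R}.
Variable mu : {outer_measure set X -> \bar R}.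
Hypothesis mms : metric_measure_space mu.
Variables (s p : R) (q : \bar R).
Hypotheses (s01 : (0 < s < 1)%R) (p0 : (0 < p)%R) (q0 : 0 < q).

Definition dyadic_radius (n : nat) : R := (2 `^ (- n%:R))%R.

Definition dyadic_ball (x : X) (n : nat) : set X := ball x (dyadic_radius n).

Definition dyadic_cutoff (x : X) (n : nat) : X -> \bar R :=
  EFin \o cutoff x (dyadic_radius n).

Definition cutoff_gradient (x : X) (n : nat) (k : int) (y : X) : \bar R :=
  (cutoff_weight s n k * \1_(dyadic_ball x n) y)%:E.

Definition decay_norm : R :=
  fine (lqnorm q (fun k => (2 * decay s ^+ `|k|%N)%:E)).

Lemma dyadic_radius_gt0 n : (0 < dyadic_radius n)%R.
Proof. exact: powR_gt0. Qed.

(** If neither point is in the ball, both sides vanish; otherwise one of the two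
    indicators is 1 and the weight alone dominates the oscillation. *)
Lemma cutoff_gradientP x n :
  fractional_gradient mu s (dyadic_cutoff x n) (cutoff_gradient x n).
Proof.
split=> [k|k y|]; first exact: measurable_scaled_ball.
  by rewrite lee_fin mulr_ge0// cutoff_weight_ge0.
exists set0; first exact: outer_measure0.
move=> k y z _ _ dyz.
rewrite /dyadic_cutoff /cutoff_gradient /= -!EFinD -EFinM lee_fin -mulrDr mulrA.
have w0 : (0 <= mdist y z `^ s * cutoff_weight s n k)%R.
  by rewrite mulr_ge0 ?powR_ge0 ?cutoff_weight_ge0.
have [[By|Bz]|nByz] := pselect (dyadic_ball x n y \/ dyadic_ball x n z).
- apply: le_trans (cutoff_osc_le_weight x y z s n k s01 dyz) _.
  apply: ler_peMr => //.
  by rewrite indicE mem_set// lerDl.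
- apply: le_trans (cutoff_osc_le_weight x y z s n k s01 dyz) _.
  apply: ler_peMr => //.
  by rewrite [X in (_ + X)%R]indicE mem_set// lerDr.
- rewrite !cutoff_out ?dyadic_radius_gt0 ?subr0 ?normr0//; last 2 first.
  + by move=> Bz; apply: nByz; right.
  + by move=> By; apply: nByz; left.
  by rewrite mulr_ge0// addr_ge0.
Qed.

Lemma lqnorm_cutoff_weight n :
  lqnorm q (fun k => (cutoff_weight s n k)%:E) =
    (2 `^ (n%:R * s) * decay_norm)%:E.
Proof.
rewrite EFinM fineK; last first.
  rewrite ge0_fin_numE ?lqnorm_ge0//; apply: lqnorm_geometric_lty => //.
  have [s0 s1] := andP s01.
  rewrite powR_gt0//= /decay powRN invf_lt1 ?powR_gt0//.
  rewrite -[ltLHS](congr1 (@^~ (s * (1 - s))%R) (powR1 R)).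
  by apply: gt0_ltr_powR; rewrite ?nnegrE ?mulr_gt0 ?subr_gt0 ?ltr1n.
by rewrite -lqnormZ ?powR_ge0// -[RHS](lqnorm_shift _ _ n%:Z).
Qed.

Lemma LplqNorm_cutoff_gradient x n :
  LplqNorm mu p%:E q (cutoff_gradient x n) =
    (2 `^ (n%:R * s) * decay_norm)%:E * mu (dyadic_ball x n) `^ p^-1.
Proof.
rewrite /LplqNorm -lpnorm_scaled_ball//; last first.
  by rewrite mulr_ge0 ?powR_ge0// fine_ge0// lqnorm_ge0.
congr lpnorm; apply/funext => y.
rewrite EFinM -lqnorm_cutoff_weight muleC -lqnormZ//.
by congr lqnorm; apply/funext => k; rewrite -EFinM mulrC.
Qed.

Lemma lqLpNorm_cutoff_gradient x n :
  lqLpNorm mu p%:E q (cutoff_gradient x n) =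
    (2 `^ (n%:R * s) * decay_norm)%:E * mu (dyadic_ball x n) `^ p^-1.
Proof.
rewrite /lqLpNorm -lqnorm_cutoff_weight muleC.
have muE : mu (dyadic_ball x n) `^ p^-1 =
    (fine (mu (dyadic_ball x n)) `^ p^-1)%:E.
  by rewrite -poweR_EFin fineK// ball_measure_fin_num.
rewrite muE -lqnormZ ?powR_ge0// -muE; congr lqnorm; apply/funext => k.
by rewrite lpnorm_scaled_ball ?cutoff_weight_ge0// muleC.
Qed.

Lemma cutoff_bound_lty x n :
  (2 `^ (n%:R * s) * decay_norm)%:E * mu (dyadic_ball x n) `^ p^-1 < +oo.
Proof.
rewrite ltey_eq fin_numM// fin_num_poweR//; exact: ball_measure_fin_num.
Qed.

Lemma lpnorm_dyadic_cutoff_lty x n :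
  lpnorm mu p%:E (dyadic_cutoff x n) < +oo.
Proof.
apply: le_lt_trans (lpnorm_cutoff_le mu mms _ _ _ _ _) _ => //.
  exact: dyadic_radius_gt0.
by rewrite ltey_eq fin_num_poweR//; exact: ball_measure_fin_num.
Qed.

(** What remains of either embedding once it is tested on cut-offs, with the
    L^p norm of the cut-off absorbed in the summand 1. *)
Definition cutoff_estimate (ps : \bar R) (Ce : R) : Prop := forall x n,
  lpnorm mu ps (dyadic_cutoff x n) <=
    Ce%:E * ((1 + 2 `^ (n%:R * s) * decay_norm)%:E *
      mu (dyadic_ball x n) `^ p^-1).

(** N stands for the homogeneous part of the norm, of Triebel-Lizorkin or of Besov
    type. *)
Lemma cutoff_estimate_of_norm ps Ce (N : (X -> \bar R) -> \bar R) :
  (0 < Ce)%R ->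
  (forall x n, lpnorm mu ps (dyadic_cutoff x n) <=
     Ce%:E * (lpnorm mu p%:E (dyadic_cutoff x n) + N (dyadic_cutoff x n))) ->
  (forall x n, N (dyadic_cutoff x n) <=
     (2 `^ (n%:R * s) * decay_norm)%:E * mu (dyadic_ball x n) `^ p^-1) ->
  cutoff_estimate ps Ce.
Proof.
move=> Ce0 emb leN x n; apply: le_trans (emb x n) _.
rewrite lee_pmul2l ?lte_fin// EFinD ge0_muleDl//; last first.
  by rewrite lee_fin mulr_ge0 ?powR_ge0// fine_ge0// lqnorm_ge0.
rewrite mul1e leeD// lpnorm_cutoff_le//; exact: dyadic_radius_gt0.
Qed.

Lemma cutoff_estimate_of_M_embedding ps Ce : (0 < Ce)%R ->
  M_embedding mu s p%:E q ps Ce -> cutoff_estimate ps Ce.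
Proof.
move=> Ce0 emb.
have leN x n : dotMnorm mu s p%:E q (dyadic_cutoff x n) <=
    (2 `^ (n%:R * s) * decay_norm)%:E * mu (dyadic_ball x n) `^ p^-1.
  rewrite -LplqNorm_cutoff_gradient; apply: ereal_inf_lbound.
  by exists (cutoff_gradient x n) => //; exact: cutoff_gradientP.
apply: (@cutoff_estimate_of_norm _ _ (dotMnorm mu s p%:E q)) => // x n.
apply: emb; split; first exact: measurable_cutoff.
  exact: lpnorm_dyadic_cutoff_lty.
exact: le_lt_trans (leN x n) (cutoff_bound_lty x n).
Qed.

Lemma cutoff_estimate_of_N_embedding ps Ce : (0 < Ce)%R ->
  N_embedding mu s p%:E q ps Ce -> cutoff_estimate ps Ce.
Proof.
move=> Ce0 emb.
have leN x n : dotNnorm mu s p%:E q (dyadic_cutoff x n) <=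
    (2 `^ (n%:R * s) * decay_norm)%:E * mu (dyadic_ball x n) `^ p^-1.
  rewrite -lqLpNorm_cutoff_gradient; apply: ereal_inf_lbound.
  by exists (cutoff_gradient x n) => //; exact: cutoff_gradientP.
apply: (@cutoff_estimate_of_norm _ _ (dotNnorm mu s p%:E q)) => // x n.
apply: emb; split; first exact: measurable_cutoff.
  exact: lpnorm_dyadic_cutoff_lty.
exact: le_lt_trans (leN x n) (cutoff_bound_lty x n).
Qed.

End CutoffGradient.

(** * Lower bound for the measure of balls *)

Section LowerBound.
Context {R : realType} {X : pmetricType R}.
Variable mu : {outer_measure set X -> \bar R}.
Hypotheses (mms : metric_measure_space mu) (dbl : doubling mu).
Variables (s p : R) (q ps : \bar R) (Ce Q : R).
Hypotheses (hs0 : (0 < s)%R) (hp : (0 < p)%R) (hq : 0 < q).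
Hypotheses (hps : p%:E < ps) (hCe : (0 < Ce)%R).
Hypothesis (hQ : (p%:E)^-1 - ps^-1 = (s / Q)%:E).

Lemma half_dyadic_radius n : (dyadic_radius n / 2 = dyadic_radius n.+1 :> R)%R.
Proof.
rewrite /dyadic_radius -(natr1 n) opprD powRD ?pnatr_eq0 ?implybT//.
by rewrite powR_inv1.
Qed.

Lemma dyadic_ball_doubling (x : X) : exists2 D : R, (0 < D)%R &
  forall n, (fine (mu (dyadic_ball x n)) <= D * fine (mu (dyadic_ball x n.+1)))%R.
Proof.
have [D D1 dblD] := dbl; exists D; first exact: lt_le_trans ltr01 D1.
move=> n; have := dblD x _ (dyadic_radius_gt0 n.+1).
rewrite -half_dyadic_radius mulrC divfK// half_dyadic_radius.
rewrite -lee_fin EFinM !fineK//; exact: ball_measure_fin_num.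
Qed.

(** The factor 2^{-Q} pays for rounding r down to a dyadic radius. *)
Definition lower_bound_constant : R :=
  let K := (Ce * (1 + decay_norm s q))%R in
  let a := fine ps^-1 in
  (expR (- ((ln K + a * Q * ln 2) / (p^-1 - a))) * 2 `^ (- Q))%R.

Lemma lower_bound_constant_gt0 : (0 < lower_bound_constant)%R.
Proof. by rewrite mulr_gt0 ?expR_gt0 ?powR_gt0. Qed.

Lemma ball_lower_bound : cutoff_estimate mu s p q ps Ce ->
  forall (x : X) (r : R), (0 < r <= 1)%R ->
  (lower_bound_constant * r `^ Q)%:E <= mu (ball x r).
Proof.
move=> est x r r01.
have ps0 : 0 < ps by apply: lt_trans hps; rewrite lte_fin.
have A0 : (0 <= decay_norm s q)%R by rewrite fine_ge0// lqnorm_ge0.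
pose a := fine ps^-1; pose b := (p^-1)%R.
have [a0 ab abQ] : [/\ 0 <= a, a < b & b - a = s / Q]%R.
  move: hQ hps ps0; rewrite /a /b inver gt_eqF//.
  case: ps => [t| |]//=; rewrite ?inver.
    rewrite !lte_fin => + pt t0; rewrite gt_eqF//= => -[->].
    by rewrite invr_ge0 (ltW t0) ltf_pV2.
  by rewrite sube0 => -[<-] _ _; rewrite subr0 invr_gt0 lexx.
have Q0 : (0 < Q)%R.
  by move: ab; rewrite -subr_gt0 abQ pmulr_rgt0// invr_gt0.
pose m n := fine (mu (dyadic_ball x n)).
have mE n : mu (dyadic_ball x n) = (m n)%:E.
  by rewrite fineK//; exact: ball_measure_fin_num.
have m0 n : (0 < m n)%R.
  by rewrite -lte_fin -mE; exact/ball_measure_gt0/dyadic_radius_gt0.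
have [D D0 mD] := dyadic_ball_doubling x.
pose K := (Ce * (1 + decay_norm s q))%R.
have K0 : (0 < K)%R by rewrite mulr_gt0// ltr_wpDr.
have mrec n : (m n.+1 `^ a <= K * 2 `^ (n%:R * s) * m n `^ b)%R.
  have := le_trans (le_lpnorm_cutoff mu mms x _ _ (dyadic_radius_gt0 n) ps0) 
    (est x n).
  rewrite half_dyadic_radius (mE n.+1) mE !poweR_EFin -!EFinM lee_fin.
  move=> /le_trans; apply; rewrite mulrA ler_wpM2r ?powR_ge0// /K -mulrA.
  rewrite ler_wpM2l ?(ltW hCe)// mulrDl mul1r mulrC lerD2r.
  (* 2^{ns} >= 1 absorbs the summand 1; this is where r <= 1 enters. *)
  by rewrite -[leLHS](powRr0 2) ler_powR ?ler1n// mulr_ge0// ltW.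
have bound :=
  dyadic_growth_lower_bound m _ _ _ _ _ _ a0 ab abQ Q0 K0 D0 m0 mD mrec.
have [n /andP[nr rn]] := dyadic_bracket r r01.
have [r0 _] := andP r01.
apply: (@le_trans _ _ (mu (dyadic_ball x n))); last first.
  apply: le_outer_measure => y; rewrite /dyadic_ball !ballEmdist/=.
  by move=> /lt_le_trans; apply.
rewrite mE lee_fin; apply: le_trans (bound n).
rewrite /lower_bound_constant -mulrA ler_wpM2l ?expR_ge0//.
have -> : (2 `^ (- n%:R * Q) = 2 `^ (- Q) * (2 * 2 `^ (- n%:R)) `^ Q :> R)%R.
  rewrite powRM ?powR_ge0// mulrA -powRD ?pnatr_eq0 ?implybT//.
  by rewrite addNr powRr0 mul1r -powRrM.
rewrite ler_wpM2l ?powR_ge0//; apply: ge0_ler_powR => //.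
- exact: ltW.
- by rewrite nnegrE ltW.
- by rewrite nnegrE mulr_ge0// powR_ge0.
Qed.

End LowerBound.

Theorem theorem2p8 (R : realType) (s p : R) (q ps : \bar R) (Ce Q : R)
    (hs0 : (0 < s)%R) (hs1 : (s < 1)%R) (hp : (0 < p)%R) (hq : 0 < q)
    (hps : p%:E < ps) (hCe : (0 < Ce)%R)
    (hQ : (p%:E)^-1 - ps^-1 = (s / Q)%:E) :
  (exists2 C : R, (0 < C)%R &
    forall (X : pmetricType R) (mu : {outer_measure set X -> \bar R}),
      metric_measure_space mu -> doubling mu ->
      M_embedding mu s p%:E q ps Ce ->
      forall (x : X) (r : R), (0 < r <= 1)%R ->
        (C * r `^ Q)%:E <= mu (ball x r)) /\
  (exists2 C : R, (0 < C)%R &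
    forall (X : pmetricType R) (mu : {outer_measure set X -> \bar R}),
      metric_measure_space mu -> doubling mu ->
      N_embedding mu s p%:E q ps Ce ->
      forall (x : X) (r : R), (0 < r <= 1)%R ->
        (C * r `^ Q)%:E <= mu (ball x r)).
Proof.
have s01 : (0 < s < 1)%R by rewrite hs0.
split; exists (lower_bound_constant s p q ps Ce Q);
  rewrite ?lower_bound_constant_gt0// => X mu mms dbl emb.
- apply: ball_lower_bound => //.
  exact: cutoff_estimate_of_M_embedding emb.
- apply: ball_lower_bound => //.
  exact: cutoff_estimate_of_N_embedding emb.
Qed.
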